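(* Let $d,n\in\mathbb{N}$, $N=(n+1)^d$, and $\mu\in\mathcal{M}$. Let $T_n$ be the moment matrix of $\mu$ with singular value decomposition $T_n=U_n\Sigma_nV_n^*$, $\Sigma_n=\operatorname{diag}(\sigma^{(n)}_j)_{j=1,\dots,N}$, and let $p_n=F_n*\mu$. Put $e_n(x)=\left(e^{-2\pi i kx}\right)_{k\in[n]}$ and denote by $u^{(n)}_j(x)$ and $v^{(n)}_j(x)$ the $j$-th entries of $e_n(x)^*U_n$ and $e_n(x)^*V_n$, respectively. Then for all $x\in\mathbb{T}^d$ $$p_n(x)=\frac{e_n(x)^*T_ne_n(x)}{(n+1)^d}=\frac{1}{(n+1)^d}\sum_{j=1}^N\sigma^{(n)}_j\,u^{(n)}_j(x)\,\overline{v^{(n)}_j(x)}.$$ If $\mu\in\mathcal{M}_{\mathbb{R}}$, then $T_n$ is Hermitian. If $\mu\in\mathcal{M}_+$, then $T_n$ is positive semi-definite, $\|p_n\|_{L^1}=\|\mu\|_{\mathrm{TV}}=1$, and $$p_n(x)=\frac{1}{(n+1)^d}\sum_{j=1}^N\sigma^{(n)}_j\left|u^{(n)}_j(x)\right|^2\qquad\text{for all }x\in\mathbb{T}^d.$$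
   Context: $\mathbb{N}=\{1,2,\dots\}$, $\mathbb{T}^d=[0,1)^d$ is the torus, $kx=k_1x_1+\dots+k_dx_d$. $\mathcal{M}$ is the set of complex Borel measures $\mu$ on $\mathbb{T}^d$ of finite total variation with $\mu(\mathbb{T}^d)=1$; $\mathcal{M}_{\mathbb{R}}$ and $\mathcal{M}_+$ are its subsets of real signed and of non-negative measures. The trigonometric moments are $\hat\mu(k)=\int_{\mathbb{T}^d}e^{-2\pi i kx}\,\mathrm{d}\mu(x)$, $k\in\mathbb{Z}^d$. With $[n]=\{0,\dots,n\}^d$, the moment matrix is $T_n=(\hat\mu(k-\ell))_{k,\ell\in[n]}\in\mathbb{C}^{N\times N}$; $U_n,V_n$ are unitary and $\sigma_j^{(n)}\ge 0$. The Fejér kernel is $F_n(x)=\sum_{k=-n}^n\left(1-\frac{|k|}{n+1}\right)e^{2\pi i kx}$ for $x\in\mathbb{T}$ and $F_n(x_1,\dots,x_d)=F_n(x_1)\cdots F_n(x_d)$ on $\mathbb{T}^d$; $p_n(x)=(F_n*\mu)(x)=\int_{\mathbb{T}^d}F_n(x-y)\,\mathrm{d}\mu(y)$. $\|\mu\|_{\mathrm{TV}}$ is the total variation. *)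

(* Defs.v *)
From HB Require Import structures.
From mathcomp Require Import all_boot all_order all_algebra.
From mathcomp Require Import complex.
From mathcomp Require Import all_classical all_reals all_analysis.

Set Implicit Arguments.
Unset Strict Implicit.
Unset Printing Implicit Defensive.

Import Order.TTheory GRing.Theory Num.Theory.
Import numFieldNormedType.Exports.

Local Open Scope classical_set_scope.
Local Open Scope complex_scope.
Local Open Scope sesquilinear_scope.
Local Open Scope ring_scope.

Section complex_measure.
Context d (T : measurableType d) (R : realType).

(* [R[i]^o] carries the usual topology of the complex plane.  Values on
   non-measurable sets are unconstrained and never used. *)
Record complex_measure := ComplexMeasure {
  cmeas :> set T -> R[i];
  cmeas0 : cmeas set0 = 0;
  cmeas_sigma_additive : forall F : (set T)^nat,
    (forall i, measurable (F i)) -> trivIset setT F ->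
    measurable (\bigcup_i F i) ->
    (\sum_(0 <= i < n) cmeas (F i) : R[i]^o) @[n --> \oo] -->
      (cmeas (\bigcup_i F i) : R[i]^o) }.

Implicit Types mu : complex_measure.

Definition tv_norm mu : \bar R :=
  ereal_sup [set (\sum_(i <oo) (Normc.normc (mu (A i)))%:E)%E |
    A in [set A : (set T)^nat | [/\ forall i, measurable (A i),
                                    trivIset setT A & \bigcup_i A i = setT]]].

Definition cmeas_re mu : set T -> \bar R := fun A => (complex.Re (mu A))%:E.
Definition cmeas_im mu : set T -> \bar R := fun A => (complex.Im (mu A))%:E.

Section parts.
Variable mu : complex_measure.

Local Fact part_sigma_additive (f : R[i] -> R) :
  f 0 = 0 -> (forall z w, f (z + w) = f z + f w) ->
  (forall z, (`|f z|)%:C <= `|z|) ->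
  semi_sigma_additive (fun A => (f (mu A))%:E).
Proof.
move=> f0 fD fle F mF tF mUF.
have fB z w : f (z - w) = f z - f w.
  by apply/eqP; rewrite eq_sym subr_eq -fD subrK.
have /cvgrPdist_lt ul := @cmeas_sigma_additive mu F mF tF mUF.
apply: cvg_EFin => /=.
  by apply: nearW => n; rewrite sumEFin.
apply/cvgrPdist_lt => e e0; have e0C : 0 < e%:C by rewrite ltcR.
near=> n.
rewrite /= sumEFin /= -(big_morph f fD f0) -fB -ltcR (le_lt_trans (fle _))//.
by near: n; apply: ul.
Unshelve. all: by end_near. Qed.

Local Fact re_sigma_additive : semi_sigma_additive (cmeas_re mu).
Proof.
apply: (part_sigma_additive (f := @complex.Re R)) => //.
- by move=> [a b] [a' b'].
- case=> a b; rewrite normc_def lecR /= -sqrtr_sqr.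
  by rewrite ler_sqrt ?addr_ge0 ?sqr_ge0// lerDl sqr_ge0.
Qed.

Local Fact im_sigma_additive : semi_sigma_additive (cmeas_im mu).
Proof.
apply: (part_sigma_additive (f := @complex.Im R)) => //.
- by move=> [a b] [a' b'].
- case=> a b; rewrite normc_def lecR /= -sqrtr_sqr.
  by rewrite ler_sqrt ?addr_ge0 ?sqr_ge0// lerDr sqr_ge0.
Qed.

Local Fact re0 : cmeas_re mu set0 = 0%E. Proof. by rewrite /cmeas_re cmeas0. Qed.
Local Fact im0 : cmeas_im mu set0 = 0%E. Proof. by rewrite /cmeas_im cmeas0. Qed.

Local Fact re_fin A : measurable A -> cmeas_re mu A \is a fin_num.
Proof. by []. Qed.
Local Fact im_fin A : measurable A -> cmeas_im mu A \is a fin_num.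
Proof. by []. Qed.

HB.instance Definition _ := isCharge.Build _ _ _ (cmeas_re mu)
  re0 re_fin re_sigma_additive.
HB.instance Definition _ := isCharge.Build _ _ _ (cmeas_im mu)
  im0 im_fin im_sigma_additive.

End parts.

(* Integral against a signed measure, through its Jordan decomposition (which
   does not depend on the Hahn decomposition picked here). *)
Definition charge_integral (nu : {charge set T -> \bar R}) (f : T -> R) : R :=
  let nuPN := svalP (cid (svalP (cid (Hahn_decomposition nu)))) in
  \int[jordan_pos nuPN]_x f x - \int[jordan_neg nuPN]_x f x.

Definition cintegral mu (f : T -> R[i]) : R[i] :=
  let fr x := complex.Re (f x) in
  let fi x := complex.Im (f x) in
  (charge_integral (cmeas_re mu) fr - charge_integral (cmeas_im mu) fi)
  +i* (charge_integral (cmeas_re mu) fi + charge_integral (cmeas_im mu) fr).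

Definition measM mu := (tv_norm mu < +oo)%E /\ mu setT = 1.

Definition measM_real mu :=
  measM mu /\ forall A, measurable A -> mu A \is Num.real.

(* In the order of [R[i]], [0 <= z] means that [z] is real and nonnegative. *)
Definition measM_pos mu := measM mu /\ forall A, measurable A -> 0 <= mu A.

End complex_measure.

Section product_probability.
Context d (T : measurableType d) (R : realType).

Definition cons_tuple n (z : T * n.-tuple T) : n.+1.-tuple T :=
  [the n.+1.-tuple T of z.1 :: z.2].

Local Fact measurable_cons_tuple n : measurable_fun setT (@cons_tuple n).
Proof. by apply: measurable_cons. Qed.

HB.instance Definition _ n :=
  isMeasurableFun.Build _ _ _ _ (@cons_tuple n) (@measurable_cons_tuple n).

Fixpoint tuple_prob (P : probability T R) n : probability (n.-tuple T) R :=
  if n is n'.+1 then distribution (P \x tuple_prob P n')%E (@cons_tuple n')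
  else \d_([tuple] : 0.-tuple T).

End product_probability.

Section torus.
Variable R : realType.

Definition circle := {x : R | x \in `[0%R, 1%R[}.

Lemma to_circle_proof (x : R) : x - (Num.floor x)%:~R \in `[0%R, 1%R[.
Proof.
rewrite in_itv /= subr_ge0 floor_le /= ltrBlDl.
by have := floorD1_gt x; rewrite rmorphD.
Qed.

(* The fractional part: reduction modulo 1. *)
Definition to_circle (x : R) : circle :=
  exist (fun y : R => y \in `[0%R, 1%R[) _ (to_circle_proof x).

HB.instance Definition _ := Choice.on circle.
HB.instance Definition _ := isPointed.Build circle (to_circle 0).

(* The trace of the Borel sets of the line.  It is also the Borel sigma-algebra
   of the quotient topology of R/Z, since the identification of [[0, 1)] with
   R/Z is a Borel isomorphism. *)
HB.instance Definition _ := Measurable.copy circle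
  (g_sigma_algebra_preimageType (sval : circle -> R)).

Definition circle_lebesgue (A : set circle) : \bar R :=
  lebesgue_measure ([set sval x | x in A] : set (measurableTypeR R)).

Local Fact measurable_image (A : set circle) : measurable A ->
  measurable ([set sval x | x in A] : set (measurableTypeR R)).
Proof.
move=> [B mB <-].
rewrite [X in measurable X](_ : _ = B `&` `[0%R, 1%R[%classic).
  exact: measurableI.
apply/seteqP; split=> [_ [y [_ By] <-]|x [Bx x01]].
  by split => //; exact: svalP y.
by exists (exist (fun y : R => y \in `[0%R, 1%R[) x x01).
Qed.

Local Fact circle_lebesgue0 : circle_lebesgue set0 = 0%E.
Proof. by rewrite /circle_lebesgue image_set0 measure0. Qed.

Local Fact circle_lebesgue_ge0 A : (0 <= circle_lebesgue A)%E.
Proof. exact: measure_ge0. Qed.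

Local Fact circle_lebesgue_sigma_additive : semi_sigma_additive circle_lebesgue.
Proof.
move=> F mF tF mUF; rewrite /circle_lebesgue image_bigcup.
apply: measure_semi_sigma_additive.
- by move=> i; exact: measurable_image.
- move=> i j _ _ [_ [[x Fix <-] [y Fjy /val_inj yx]]].
  by apply: tF => //; exists x; split=> //; rewrite -yx.
- by rewrite -image_bigcup; exact: measurable_image.
Qed.

HB.instance Definition _ := isMeasure.Build _ _ _ circle_lebesgue
  circle_lebesgue0 circle_lebesgue_ge0 circle_lebesgue_sigma_additive.

Local Fact circle_lebesgueT : circle_lebesgue setT = 1%E.
Proof.
rewrite /circle_lebesgue [X in lebesgue_measure X](_ : _ = `[0%R, 1%R[%classic).
  by rewrite lebesgue_measure_itv /= lte_fin ltr01 sube0.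
apply/seteqP; split=> [_ [y _ <-]|x x01]; first exact: svalP y.
by exists (exist (fun y : R => y \in `[0%R, 1%R[) x x01).
Qed.

HB.instance Definition _ := Measure_isProbability.Build _ _ _ circle_lebesgue
  circle_lebesgueT.

Variable d : nat.

Definition torus := (d.-tuple circle)%type.

Definition coord (x : torus) (i : 'I_d) : R := sval (tnth x i).

(* Subtraction in the group (R/Z)^d. *)
Definition tsub (x y : torus) : torus :=
  [tuple to_circle (coord x i - coord y i) | i < d].

(* Lebesgue measure on [[0, 1)^d]. *)
Definition torus_lebesgue : probability torus R := tuple_prob circle_lebesgue d.

Definition torus_L1norm (f : torus -> R[i]) : \bar R :=
  (\int[torus_lebesgue]_x (Normc.normc (f x))%:E)%E.

Definition expi2pi (t : R) : R[i] := cos (2 * pi * t) +i* sin (2 * pi * t).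

Definition dotp (k : 'I_d -> int) (x : torus) : R :=
  \sum_(i < d) (k i)%:~R * coord x i.

Definition moment (mu : complex_measure torus R) (k : 'I_d -> int) : R[i] :=
  cintegral mu (fun x => expi2pi (- dotp k x)).

(* The sum over -n <= k <= n, with k = j - n. *)
Definition fejer1 (n : nat) (t : R) : R[i] :=
  \sum_(j < n.*2.+1) let k : int := j%:Z - n%:Z in
    (1 - `|k|%:~R / n.+1%:R) * expi2pi (k%:~R * t).

Definition fejer (n : nat) (x : torus) : R[i] :=
  \prod_(i < d) fejer1 n (coord x i).

Definition fejer_conv (mu : complex_measure torus R) (n : nat) (x : torus) :
    R[i] :=
  cintegral mu (fun y => fejer n (tsub x y)).

Lemma card_multi_index n : (n.+1 ^ d)%N = #|{ffun 'I_d -> 'I_n.+1}|.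
Proof. by rewrite card_ffun !card_ord. Qed.

(* An enumeration of the multi-indices [{0, ..., n}^d]. *)
Definition multi_index n (j : 'I_(n.+1 ^ d)) : 'I_d -> int :=
  fun i => (enum_val (cast_ord (card_multi_index n) j) i : nat)%:Z.

Definition moment_mx (mu : complex_measure torus R) (n : nat) :
    'M[R[i]]_(n.+1 ^ d) :=
  \matrix_(j, l) moment mu (fun i => multi_index j i - multi_index l i).

Definition expvec (n : nat) (x : torus) : 'cV[R[i]]_(n.+1 ^ d) :=
  \col_j expi2pi (- dotp (multi_index j) x).

End torus.

Section matrices.
Variables (R : realType) (N : nat).

Definition is_svd (A U : 'M[R[i]]_N) (s : 'I_N -> R) (V : 'M[R[i]]_N) : Prop :=
  [/\ U \is unitarymx, V \is unitarymx, forall j, 0 <= s j &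
      A = U *m diag_mx (\row_j (s j)%:C) *m V^t*].

Definition psdmx (A : 'M[R[i]]_N) : Prop :=
  A \is hermsymmx /\ forall v : 'cV[R[i]]_N, 0 <= (v^t* *m A *m v) 0 0.

End matrices.

(* Main.v *)
(** Writing the Fejer kernel as
    [F_n(z) = (n+1)^-d * sum_(k,l in [n]) e^(2 pi i (k-l)z)] and integrating termwise against [mu] gives [p_n = e_n^* T_n e_n / (n+1)^d];
    the singular value expansion follows by inserting [T_n = U S V^*].  For
    [mu >= 0], [v^* T_n v] is the integral of [|sum_k conj(v_k) e^(-2 pi i k y)|^2],
    hence nonnegative; so [p_n >= 0] and its L1 norm is its zeroth Fourier
    coefficient [mu(T^d) = 1].  Finally [U^* T_n U] and [S] are positive
    semi-definite with the same square, hence equal, so [T_n = U S U^*]. *)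

Require Import Defs.
From HB Require Import structures.
From mathcomp Require Import all_boot all_order all_algebra.
From mathcomp Require Import complex.
From mathcomp Require Import all_classical all_reals all_analysis.
From mathcomp Require Import measurable_realfun.
From mathcomp Require Import ring.

Import Order.TTheory GRing.Theory Num.Theory.
Import numFieldNormedType.Exports.

Local Open Scope complex_scope.
Local Open Scope sesquilinear_scope.
Local Open Scope ring_scope.

Set Implicit Arguments.
Unset Strict Implicit.

(** * Singular values of positive semi-definite matrices *)

Section psd_svd.
Variables (C : numClosedFieldType) (N : nat).
Implicit Types A B U V D : 'M[C]_N.

Lemma conjtM m n p (A : 'M[C]_(m, n)) (B : 'M[C]_(n, p)) :
  (A *m B)^t* = B^t* *m A^t*.
Proof. by rewrite trmx_mul map_mxM. Qed.

Lemma hermsymmxP A : reflect (A^t* = A) (A \is hermsymmx).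
Proof.
by rewrite qualifE /= expr0 scale1r eq_sym; exact: eqP.
Qed.

(** The [i]-th diagonal entry of [D D = D D^*] is the sum of the [|D i j|^2], so its vanishing kills
    row [i]. *)
Lemma hermsymmx_sqr_eq0 D : D^t* = D -> D *m D = 0 -> D = 0.
Proof.
move=> hD D2; apply/matrixP => i j; rewrite [RHS]mxE; apply/eqP.
have : (D *m D^t*) i i = 0 by rewrite hD D2 mxE.
rewrite mxE => /psumr_eq0P /(_ j isT).
rewrite !mxE -normCK => D2ij; rewrite -normr_eq0 -sqrf_eq0 D2ij// => k _.
by rewrite !mxE -normCK exprn_ge0.
Qed.

(* With [D = M - S], commutation turns [M^2 = S^2] into [(M + S) D = 0]; for
   [w = D x] both nonnegative numbers [w^* M w] and [w^* S w] then vanish, so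
   [S w = 0 = M w] and [D w = 0]. *)
Lemma psd_sqr_diag M (s : 'I_N -> C) (S := diag_mx (\row_j s j)) :
  (forall j, 0 <= s j) -> M^t* = M ->
  (forall v : 'cV[C]_N, 0 <= (v^t* *m M *m v) 0 0) ->
  M *m M = S *m S -> M = S.
Proof.
move=> s0 hM M0 MS2.
have hS : S^t* = S.
  rewrite /S tr_diag_mx; apply/matrixP => i j; rewrite !mxE.
  by rewrite rmorphMn /= geC0_conj.
have SE i j : S i j = s i *+ (i == j) by rewrite !mxE.
have SlE p (B : 'M[C]_(N, p)) i j : (S *m B) i j = s i * B i j.
  by rewrite /S mul_diag_mx !mxE.
have SrE B i j : (B *m S) i j = B i j * s j by rewrite /S mul_mx_diag !mxE.
(* [M] commutes with [S^2 = M^2], that is [M i j * s_j^2 = s_i^2 * M i j]. So [M i j = 0] or, the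
   [s_j] being nonnegative, [s_i = s_j]. *)
have MSC : M *m S = S *m M.
  have MS2C : M *m (S *m S) = (S *m S) *m M by rewrite -MS2 !mulmxA.
  apply/matrixP => i j; rewrite SrE SlE.
  move/matrixP: MS2C => /(_ i j).
  rewrite mulmxA !SrE -mulmxA !SlE mulrA => /eqP.
  rewrite -mulrA mulrC -subr_eq0 -mulrBl mulf_eq0 -!expr2 subr_eq0.
  rewrite eqrXn2// => /orP[/eqP -> |/eqP ->]; first exact: mulrC.
  by rewrite mul0r mulr0.
pose D := M - S.
have MSD : M *m D = - (S *m D).
  apply/eqP; by rewrite -addr_eq0 !mulmxBr MS2 MSC addrA subrK subrr.
suff SD : S *m D = 0.
  apply/eqP; rewrite -subr_eq0; apply/eqP/hermsymmx_sqr_eq0.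
    by rewrite linearB /= map_mxB hM hS.
  by rewrite mulmxBl MSD SD oppr0 addr0.
apply/matrixP => i j; rewrite SlE [RHS]mxE.
pose w := col j D.
have Mw : M *m w = - (S *m w).
  by rewrite /w colE !mulmxA MSD mulNmx.
have wSw : (w^t* *m S *m w) 0 0 = \sum_k s k * `|D k j| ^+ 2.
  rewrite -mulmxA mxE; apply: eq_bigr => k _.
  by rewrite SlE !mxE mulrCA normCKC.
have /psumr_eq0P : \sum_k s k * `|D k j| ^+ 2 = 0.
  apply/le_anti; rewrite sumr_ge0 ?andbT; last first.
    by move=> k _; rewrite mulr_ge0 ?exprn_ge0.
  rewrite -wSw -oppr_ge0; apply: le_trans (M0 w) _.
  by rewrite -!mulmxA Mw mulmxN mxE.
move=> /(_ _ i isT) /eqP; rewrite mulf_eq0 sqrf_eq0 normr_eq0 -mulf_eq0.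
by move=> sD; apply/eqP/sD => k _; rewrite mulr_ge0 ?exprn_ge0.
Qed.

(** The factor [V] cancels in [A A^*], so the positive Hermitian matrix [U^* A U] has square [S^2],
    and [psd_sqr_diag] identifies it with [S]. *)
Lemma svd_psd (A U V : 'M[C]_N) (s : 'I_N -> C) :
  U \is unitarymx -> V \is unitarymx -> (forall j, 0 <= s j) ->
  A = U *m diag_mx (\row_j s j) *m V^t* ->
  A \is hermsymmx -> (forall v : 'cV[C]_N, 0 <= (v^t* *m A *m v) 0 0) ->
  A = U *m diag_mx (\row_j s j) *m U^t*.
Proof.
move=> uU uV s0 AE /hermsymmxP hA A0; set S := diag_mx _ in AE *.
have UU : U^t* *m U = 1%:M.
  by apply: mulmx1C; exact/unitarymxP.
have UU' : U *m U^t* = 1%:M by exact/unitarymxP.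
have VV : V^t* *m V = 1%:M by apply: mulmx1C; exact/unitarymxP.
have hS : S^t* = S.
  rewrite /S tr_diag_mx; apply/matrixP => i j; rewrite !mxE.
  by rewrite rmorphMn /= geC0_conj.
have ME : U^t* *m A *m U = S.
  apply: psd_sqr_diag => //.
  - by rewrite !conjtM trmxCK hA mulmxA.
  - move=> v; have := A0 (U *m v).
    by rewrite conjtM !mulmxA.
  - transitivity (U^t* *m (A *m A^t*) *m U).
      by rewrite hA !mulmxA -[_ *m U *m U^t*]mulmxA UU' mulmx1.
    rewrite AE !conjtM trmxCK hS !mulmxA UU mul1mx.
    rewrite -[_ *m V^t* *m V]mulmxA VV mulmx1.
    by rewrite -mulmxA UU mulmx1.
by rewrite -ME !mulmxA UU' mul1mx -mulmxA UU' mulmx1.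
Qed.

End psd_svd.

(** * The Fejer kernel *)

(** The weight [n + 1 - |m|] counts the pairs [(a, b)] with [a - b = m]. Passing from [n] to [n + 1]
    raises every weight by one, matching the [2n + 3] new pairs, whose differences run once through
    [-(n + 1), ..., n + 1]. *)
Lemma sum_diff_fejer (C : numFieldType) (E : int -> C) n :
  \sum_(j < n.*2.+1) (n.+1%:R - `|j%:Z - n%:Z|%:~R) * E (j%:Z - n%:Z) =
  \sum_(a < n.+1) \sum_(b < n.+1) E (a%:Z - b%:Z).
Proof.
elim: n => [|n IHn].
  by rewrite !big_ord_recl !big_ord0 /= !subr0 !addr0 mul1r.
transitivity (\sum_(j < n.*2.+3)
    (n.+1%:R - `|j%:Z - n.+1%:Z|%:~R) * E (j%:Z - n.+1%:Z) +
  \sum_(j < n.+1 + n.+2) E (j%:Z - n.+1%:Z)).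
  have -> : (n.+1 + n.+2)%N = n.*2.+3 by rewrite addnS addSn addnS addnn.
  rewrite -big_split /=; apply: eq_bigr => j _.
  by rewrite -[n.+2%:R]natr1 addrAC mulrDl mul1r.
(* The extreme differences [-(n + 1)] and [n + 1] have weight zero here; what remains is the sum of
   the induction hypothesis. *)
have -> : \sum_(j < n.*2.+3)
    (n.+1%:R - `|j%:Z - n.+1%:Z|%:~R) * E (j%:Z - n.+1%:Z) =
    \sum_(a < n.+1) \sum_(b < n.+1) E (a%:Z - b%:Z).
  rewrite -IHn big_ord_recl big_ord_recr /=.
  have -> : `|0 - n.+1%:Z|%:~R = n.+1%:R :> C by rewrite sub0r normrN.
  have -> : (bump 0 n.*2.+1)%:Z - n.+1%:Z = n.+1%:Z.
    by rewrite /bump /= add1n -doubleS -addnn PoszD addrK.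
  rewrite subrr !mul0r add0r addr0; apply: eq_bigr => j _.
  rewrite /bump /= add1n.
  rewrite (_ : j.+1%:Z - n.+1%:Z = j%:Z - n%:Z)//.
  by rewrite !intS opprD addrACA subrr add0r.
rewrite [RHS]big_ord_recr /=.
under [in RHS]eq_bigr do rewrite big_ord_recr /=.
rewrite big_split /= -addrA; congr (_ + _).
rewrite big_split_ord /=; congr (_ + _).
(* The new column has given the negative differences; the new row is read backwards, so that its
   differences increase from 0 to [n + 1]. *)
rewrite [RHS](reindex_inj rev_ord_inj) /=; apply: eq_bigr => b _.
congr (E _); rewrite PoszD [LHS]addrAC subrr add0r subSS -subzn; last first.
  by rewrite -ltnS.
by rewrite opprB addrCA subrr addr0.
Qed.

Section fejer_kernel.
Variable R : realType.
Implicit Types s t : R.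

Lemma expi2piD s t : expi2pi (s + t) = expi2pi s * expi2pi t.
Proof.
by apply/eqP; rewrite eq_complex /= !mulrDr cosD sinD addrC eqxx andTb addrC.
Qed.

Lemma expi2pi0 : expi2pi (0 : R) = 1.
Proof. by rewrite /expi2pi mulr0 cos0 sin0. Qed.

Lemma expi2piN t : expi2pi (- t) = (expi2pi t)^*.
Proof. by rewrite /expi2pi mulrN cosN sinN. Qed.

Lemma expi2pi_sum (I : Type) (r : seq I) (P : pred I) (F : I -> R) :
  expi2pi (\sum_(i <- r | P i) F i) = \prod_(i <- r | P i) expi2pi (F i).
Proof. exact: (big_morph _ expi2piD expi2pi0). Qed.

Lemma expi2pi_int (m : int) : expi2pi (m%:~R : R) = 1.
Proof.
have expi2pi_nat k : expi2pi (k%:R : R) = 1.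
  elim: k => [|k IHk]; first exact: expi2pi0.
  rewrite -natr1 expi2piD IHk mul1r /expi2pi mulr1 mulr_natl.
  by rewrite cos2pi sin2pi.
case: m => k; first exact: expi2pi_nat.
by rewrite NegzE mulrNz expi2piN expi2pi_nat rmorph1.
Qed.

(** Reduction modulo 1 subtracts an integer, which an exponential of integer frequency does not
    see. *)
Lemma expi2pi_to_circle (m : int) t :
  expi2pi (m%:~R * sval (to_circle t)) = expi2pi (m%:~R * t).
Proof.
by rewrite /= mulrBr -intrM expi2piD expi2piN expi2pi_int rmorph1 mulr1.
Qed.

Lemma fejer1E n t : fejer1 n t =
  n.+1%:R^-1 * \sum_(a < n.+1) \sum_(b < n.+1) expi2pi ((a%:Z - b%:Z)%:~R * t).
Proof.
rewrite -(sum_diff_fejer (fun m => expi2pi (m%:~R * t))) mulr_sumr.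
apply: eq_bigr => j _; rewrite /= mulrA mulrBr mulVf ?pnatr_eq0//.
by rewrite [n.+1%:R^-1 * _]mulrC.
Qed.

Variable d : nat.
Implicit Types (x y : torus R d) (k l : 'I_d -> int).

Lemma dotpB k l x : dotp (fun i => k i - l i) x = dotp k x - dotp l x.
Proof.
rewrite /dotp -sumrB; apply: eq_bigr => i _.
by rewrite rmorphB mulrBl.
Qed.

Lemma expi2pi_dotp_tsub k x y :
  expi2pi (dotp k (tsub x y)) = expi2pi (dotp k x) * expi2pi (- dotp k y).
Proof.
rewrite -expi2piD /dotp -sumrB !expi2pi_sum; apply: eq_bigr => i _.
by rewrite {1}/Defs.coord /tsub tnth_mktuple expi2pi_to_circle mulrBr.
Qed.

(** Trades matrix indices for functions from coordinates to [{0, ..., n}], the form in which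
    distributivity expands a product of sums. *)
Lemma sum_multi_index (V : nmodType) n (F : ('I_d -> int) -> V) :
  \sum_j F (@multi_index d n j) =
  \sum_(f : {ffun 'I_d -> 'I_n.+1}) F (fun i => (f i : nat)%:Z).
Proof.
rewrite (reindex_onto (cast_ord (esym (card_multi_index d n)) \o enum_rank)
  (enum_val \o cast_ord (card_multi_index d n))) /=; last first.
  by move=> j _; rewrite enum_valK cast_ordK.
apply: eq_big => [f|f _]; first by rewrite cast_ordKV enum_rankK eqxx.
by rewrite /multi_index cast_ordKV enum_rankK.
Qed.

Lemma fejerE n x : fejer n x = (n.+1%:R ^+ d)^-1 *
  \sum_(j < n.+1 ^ d) \sum_(l < n.+1 ^ d)
    expi2pi (dotp (fun i => multi_index j i - multi_index l i) x).
Proof.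
rewrite /fejer; under eq_bigr do rewrite fejer1E.
rewrite big_split /= prodr_const card_ord exprVn; congr (_ * _).
under [RHS]eq_bigr => j _.
  rewrite (sum_multi_index n (fun k => expi2pi (dotp (fun i => _ i - k i) x))).
  over.
rewrite (sum_multi_index n (fun k => \sum_(f : {ffun 'I_d -> 'I_n.+1})
  expi2pi (dotp (fun i => k i - (f i : nat)%:Z) x))).
(* In each coordinate the double sum factors into a sum over [a] times a sum over [b]; distributing
   the two products separately yields two independent multi-indices. *)
transitivity (\prod_(i < d) ((\sum_(a < n.+1) expi2pi (a%:Z%:~R * Defs.coord x i)) *
    \sum_(b < n.+1) expi2pi (- (b%:Z%:~R * Defs.coord x i)))).
  apply: eq_bigr => i _; rewrite big_distrlr /=; apply: eq_bigr => a _.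
  by apply: eq_bigr => b _; rewrite -expi2piD rmorphB mulrBl.
rewrite big_split /= !bigA_distr_bigA big_distrlr /=.
apply: eq_bigr => f _; apply: eq_bigr => g _.
rewrite dotpB expi2piD -!expi2pi_sum; congr (_ * _).
by rewrite sumrN.
Qed.

End fejer_kernel.

(** * Integration against complex measures *)

Section bounded_measurable.
Context d (T : measurableType d) (R : realType).
Implicit Types (f g : T -> R) (h : T -> R[i]).

(** A class stable under sums and products and integrable for every finite measure; it supplies the
    integrability behind each use of linearity below. *)
Definition bounded_measurable f :=
  measurable_fun setT f /\ exists M, forall x, `|f x| <= M.

Lemma bounded_measurable_cst (a : R) : bounded_measurable (fun=> a).
Proof. by split; [exact: measurable_cst | exists `|a|]. Qed.

Lemma bounded_measurableD f g : bounded_measurable f ->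
  bounded_measurable g -> bounded_measurable (fun x => f x + g x).
Proof.
move=> [mf [a fa]] [mg [b gb]]; split; first exact: measurable_funD.
by exists (a + b) => x; rewrite (le_trans (ler_normD _ _))// lerD.
Qed.

Lemma bounded_measurableM f g : bounded_measurable f ->
  bounded_measurable g -> bounded_measurable (fun x => f x * g x).
Proof.
move=> [mf [a fa]] [mg [b gb]]; split; first exact: measurable_funM.
by exists (a * b) => x; rewrite normrM ler_pM.
Qed.

Lemma bounded_measurableN f : bounded_measurable f ->
  bounded_measurable (fun x => - f x).
Proof.
move=> [mf [a fa]]; split; first exact: measurable_funN.
by exists a => x; rewrite normrN.
Qed.

Lemma bounded_measurable_integrable (m : {finite_measure set T -> \bar R}) f :
  bounded_measurable f -> m.-integrable setT (EFin \o f).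
Proof.
move=> [mf [a fa]]; apply: measurable_bounded_integrable => //.
  exact: fin_num_fun_lty.
exists a; split; first exact: num_real.
by move=> b /ltW ab x _; exact: le_trans (fa x) ab.
Qed.

Definition cbounded_measurable h :=
  bounded_measurable (fun x => complex.Re (h x)) /\
  bounded_measurable (fun x => complex.Im (h x)).

Lemma cbounded_measurable_cst (c : R[i]) : cbounded_measurable (fun=> c).
Proof. by split; exact: bounded_measurable_cst. Qed.

Lemma ReD (z w : R[i]) : complex.Re (z + w) = complex.Re z + complex.Re w.
Proof. by case: z w => [a b] [a' b']. Qed.

Lemma ImD (z w : R[i]) : complex.Im (z + w) = complex.Im z + complex.Im w.
Proof. by case: z w => [a b] [a' b']. Qed.

Lemma cbounded_measurableD (h k : T -> R[i]) : cbounded_measurable h ->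
  cbounded_measurable k -> cbounded_measurable (fun x => h x + k x).
Proof.
move=> [h1 h2] [k1 k2]; split.
- by under eq_fun do rewrite ReD; exact: bounded_measurableD.
- by under eq_fun do rewrite ImD; exact: bounded_measurableD.
Qed.

Lemma ReM (z w : R[i]) : complex.Re (z * w) =
  complex.Re z * complex.Re w - complex.Im z * complex.Im w.
Proof. by case: z w => [a b] [a' b']. Qed.

Lemma ImM (z w : R[i]) : complex.Im (z * w) =
  complex.Re z * complex.Im w + complex.Im z * complex.Re w.
Proof. by case: z w => [a b] [a' b']. Qed.

Lemma cbounded_measurableM (h k : T -> R[i]) : cbounded_measurable h ->
  cbounded_measurable k -> cbounded_measurable (fun x => h x * k x).
Proof.
move=> [h1 h2] [k1 k2]; split.
- under eq_fun do rewrite ReM; apply: bounded_measurableD.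
    exact: bounded_measurableM.
  exact/bounded_measurableN/bounded_measurableM.
- under eq_fun do rewrite ImM; apply: bounded_measurableD.
    exact: bounded_measurableM.
  exact: bounded_measurableM.
Qed.

Lemma cbounded_measurable_sum (I : Type) (r : seq I) (F : I -> T -> R[i]) :
  (forall i, cbounded_measurable (F i)) ->
  cbounded_measurable (fun x => \sum_(i <- r) F i x).
Proof.
move=> mF; elim: r => [|i r IHr].
  by under eq_fun do rewrite big_nil; exact: cbounded_measurable_cst.
by under eq_fun do rewrite big_cons; exact: cbounded_measurableD.
Qed.

End bounded_measurable.

(** * Integrals against signed measures *)

Section charge_integral.
Context d (T : measurableType d) (R : realType).
Variable nu : {charge set T -> \bar R}.
Implicit Types f g : T -> R.

Let int_bm := @bounded_measurable_integrable d T R.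

Lemma charge_integralD f g : bounded_measurable f -> bounded_measurable g ->
  charge_integral nu (fun x => f x + g x) =
  charge_integral nu f + charge_integral nu g.
Proof.
move=> mf mg; rewrite /charge_integral /= !RintegralD//; try exact: int_bm.
by rewrite opprD addrACA.
Qed.

Lemma charge_integralZ (a : R) f : bounded_measurable f ->
  charge_integral nu (fun x => a * f x) = a * charge_integral nu f.
Proof.
move=> mf; rewrite /charge_integral /= !RintegralZl//; try exact: int_bm.
by rewrite mulrBr.
Qed.

Lemma jordanE P N (nuPN : hahn_decomposition nu P N) A : measurable A ->
  nu A = (jordan_pos nuPN A - jordan_neg nuPN A)%E.
Proof.
by move=> mA; rewrite [LHS](jordan_decomp nuPN mA) -mulN1e.
Qed.

Lemma charge_integral1 : charge_integral nu (fun=> 1) = fine (nu setT).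
Proof.
rewrite /charge_integral /= !Rintegral_cst// !mul1r.
set nuPN := svalP (cid (svalP (cid (Hahn_decomposition nu)))).
rewrite (jordanE nuPN)// fineB//; exact: fin_num_measure.
Qed.

Lemma Rintegral_null (m : {measure set T -> \bar R}) f :
  (forall A, measurable A -> m A = 0%E) -> \int[m]_x f x = 0.
Proof.
move=> m0; rewrite /Rintegral (eq_measure_integral mzero).
  by rewrite integral_measure_zero.
by move=> A mA _; rewrite m0.
Qed.

(** The negative Jordan part of [A] is minus [nu] of the intersection of [A] with the negative Hahn
    set. Being both nonnegative and nonpositive it vanishes, and the positive part is the required
    measure. *)
Lemma charge_integral_pos : (forall A, measurable A -> 0 <= nu A)%E ->
  exists m : {finite_measure set T -> \bar R},
    (forall A, measurable A -> m A = nu A) /\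
    forall f, charge_integral nu f = \int[m]_x f x.
Proof.
move=> nu0; rewrite /charge_integral /=.
set nuPN := svalP (cid (svalP (cid (Hahn_decomposition nu)))).
have neg0 A : measurable A -> jordan_neg nuPN A = 0%E.
  move=> mA; apply/le_anti; rewrite measure_ge0 andbT.
  rewrite jordan_negE charge.cjordan_negE /crestr0 mem_set// /crestr oppe_le0.
  apply: nu0; apply: measurableI => //.
  by case: nuPN => _ [].
exists (jordan_pos nuPN); split.
- by move=> A mA; rewrite (jordanE nuPN)// neg0// sube0.
- by move=> f; rewrite (Rintegral_null _ neg0) subr0.
Qed.

Lemma charge_integral_null f : (forall A, measurable A -> nu A = 0)%E ->
  charge_integral nu f = 0.
Proof.
move=> nu0; have [|m [mE ->]] := charge_integral_pos.
  by move=> A mA; rewrite nu0.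
by apply: (@Rintegral_null m f) => A mA; rewrite [LHS]mE// nu0.
Qed.

End charge_integral.

(** * Integrals against complex measures *)

Section complex_integral.
Context d (T : measurableType d) (R : realType).
Variable mu : complex_measure T R.
Implicit Types h k : T -> R[i].

Lemma cintegralD h k : cbounded_measurable h -> cbounded_measurable k ->
  cintegral mu (fun x => h x + k x) = cintegral mu h + cintegral mu k.
Proof.
move=> [h1 h2] [k1 k2]; rewrite /cintegral.
rewrite (funext (fun x => ReD (h x) (k x))) (funext (fun x => ImD (h x) (k x))).
rewrite !charge_integralD//; apply/eqP; rewrite eq_complex /=.
by rewrite opprD addrACA eqxx /= addrACA.
Qed.

Lemma cintegralZ (c : R[i]) h : cbounded_measurable h ->
  cintegral mu (fun x => c * h x) = c * cintegral mu h.
Proof.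
move=> [h1 h2]; rewrite /cintegral.
rewrite (funext (fun x => ReM c (h x))) (funext (fun x => ImM c (h x))).
have bmZ a f : bounded_measurable f -> bounded_measurable (fun x => a * f x).
  by apply: bounded_measurableM; exact: bounded_measurable_cst.
under [fun x => _ - _]eq_fun do rewrite -mulNr.
rewrite !charge_integralD ?charge_integralZ//; try exact: bmZ.
case: c => a b /=; apply/eqP; rewrite eq_complex /=.
by apply/andP; split; apply/eqP; ring.
Qed.

Lemma cintegral_sum (I : Type) (r : seq I) (F : I -> T -> R[i]) :
  (forall i, cbounded_measurable (F i)) ->
  cintegral mu (fun x => \sum_(i <- r) F i x) =
  \sum_(i <- r) cintegral mu (F i).
Proof.
move=> mF; elim: r => [|i r IHr].
  (* The empty sum is written [0 * 0], so that its integral vanishes by homogeneity. *)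
  under eq_fun do rewrite big_nil -(mul0r 0).
  rewrite big_nil cintegralZ ?mul0r//; exact: cbounded_measurable_cst.
rewrite big_cons -IHr; under eq_fun do rewrite big_cons.
by apply: cintegralD => //; exact: cbounded_measurable_sum.
Qed.

Lemma cintegral1 : cintegral mu (fun=> 1) = mu setT.
Proof.
rewrite /cintegral /= !charge_integral1 /= /cmeas_re /cmeas_im /=.
have int0 (nu : {charge set T -> \bar R}) : charge_integral nu (fun=> 0) = 0.
  under eq_fun do rewrite -(mul0r 0).
  rewrite charge_integralZ ?mul0r//; exact: bounded_measurable_cst.
by rewrite !int0 subr0 add0r; case: (mu setT).
Qed.

(** The imaginary charge is null, so the real and imaginary parts of [h] are integrated separately;
    conjugation and positivity rest on this form. *)
Lemma cintegral_real h :
  (forall A, measurable A -> mu A \is Num.real) ->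
  cintegral mu h = charge_integral (cmeas_re mu) (fun x => complex.Re (h x))
    +i* charge_integral (cmeas_re mu) (fun x => complex.Im (h x)).
Proof.
move=> mu_real; rewrite /cintegral.
rewrite ![charge_integral (cmeas_im mu) _]charge_integral_null.
- by rewrite subr0 addr0.
- by move=> A mA; rewrite /= /cmeas_im; have /complex_realP[a ->] := mu_real _ mA.
- by move=> A mA; rewrite /= /cmeas_im; have /complex_realP[a ->] := mu_real _ mA.
Qed.

Lemma conj_cintegral h : (forall A, measurable A -> mu A \is Num.real) ->
  cbounded_measurable h ->
  (cintegral mu h)^* = cintegral mu (fun x => (h x)^*).
Proof.
move=> mu_real [h1 h2]; rewrite !cintegral_real//.
have conjE (z : R[i]) : z^* = complex.Re z -i* complex.Im z by case: z.
have -> : (fun x => complex.Re (h x)^*) = (fun x => complex.Re (h x)).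
  by apply/funext => x; rewrite conjE.
have -> : (fun x => complex.Im (h x)^*) = (fun x => -1 * complex.Im (h x)).
  by apply/funext => x; rewrite conjE mulN1r.
by rewrite charge_integralZ// mulN1r conjE.
Qed.

Lemma cintegral_ge0 h : (forall A, measurable A -> 0 <= mu A) ->
  (forall x, 0 <= h x) -> 0 <= cintegral mu h.
Proof.
move=> mu0 h0; rewrite cintegral_real; last by move=> A /mu0 /ger0_real.
have [|m [_ mE]] := @charge_integral_pos _ _ _ (cmeas_re mu).
  by move=> A /mu0; rewrite /= /cmeas_re lee_fin lecE => /andP[].
rewrite !mE lecE /=; apply/andP; split.
  under eq_Rintegral do rewrite ger0_Im//.
  by rewrite Rintegral_cst// mul0r.
apply: Rintegral_ge0 => x _; have := h0 x.
by rewrite lecE => /andP[].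
Qed.

End complex_integral.

(** * Integrals of trigonometric polynomials on the torus *)

Section torus_integral.
Local Open Scope classical_set_scope.
Local Open Scope ring_scope.
Variable R : realType.

Lemma measurable_sval_circle : measurable_fun setT (sval : circle R -> R).
Proof. by move=> _ B mB; exists B. Qed.

Lemma measurable_coord d (i : 'I_d) :
  measurable_fun setT (fun x : torus R d => Defs.coord x i).
Proof.
apply: (measurableT_comp measurable_sval_circle).
exact: (measurable_tnth i).
Qed.

Lemma measurable_dotp d (k : 'I_d -> int) :
  measurable_fun setT (fun x : torus R d => dotp k x).
Proof.
apply: measurable_sum => i; apply: measurable_funM => //.
exact: measurable_coord.
Qed.

Lemma bounded_measurable_cos (d : measure_display) (T : measurableType d)
  (f : T -> R) : measurable_fun setT f ->
  bounded_measurable (fun x => cos (f x)).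
Proof.
move=> mf; split; last by exists 1 => x; exact: cos_max.
apply: measurableT_comp => //.
by apply: continuous_measurable_fun; exact: continuous_cos.
Qed.

Lemma bounded_measurable_sin (d : measure_display) (T : measurableType d)
  (f : T -> R) : measurable_fun setT f ->
  bounded_measurable (fun x => sin (f x)).
Proof.
move=> mf; split; last by exists 1 => x; exact: sin_max.
apply: measurableT_comp => //.
by apply: continuous_measurable_fun; exact: continuous_sin.
Qed.

(** The map [sval] carries [circle_lebesgue] to Lebesgue measure on [[0, 1)]; the null endpoint 1 is
    added to suit the fundamental theorem of calculus. *)
Lemma integral_circle (f : R -> R) : bounded_measurable f ->
  (\int[circle_lebesgue (R := R)]_x (f (sval x))%:E =
   \int[lebesgue_measure]_(x in `[0%R, 1%R]%classic) (f x)%:E)%E.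
Proof.
move=> bf; have [mf _] := bf.
have mE : measurable_fun setT (EFin \o f) by exact/measurable_EFinP.
rewrite -integral_itv_bndo_bndc; last exact: measurable_funTS.
have ms : measurable_fun setT (sval : circle R -> measurableTypeR R).
  exact: measurable_sval_circle.
pose s : {mfun circle R >-> measurableTypeR R} := mfun_Sub (mem_set ms).
have s01 : s @^-1` `[0%R, 1%R[ = setT.
  by apply/seteqP; split => // x _ /=; exact: (svalP x).
transitivity (\int[circle_lebesgue (R := R)]_(x in s @^-1` `[0%R, 1%R[)
    ((EFin \o f) \o s) x)%E.
  by rewrite s01.
rewrite -integral_pushforward//; last first.
  rewrite s01.
  apply: (@bounded_measurable_integrable _ _ _ (@circle_lebesgue R) (f \o sval)).
  have [_ [M fM]] := bf; split; last by exists M => x; exact: fM.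
  exact: (measurableT_comp mf measurable_sval_circle).
(* The measures need only agree on measurable subsets of [[0, 1)], whose points all come from the
   circle. *)
apply: eq_measure_integral => A mA A01.
rewrite /= /pushforward /= /circle_lebesgue; congr (_ _).
apply/seteqP; split=> [_ [x Ax <-]//|x Ax].
by exists (exist (fun y : R => y \in `[0%R, 1%R[) x (A01 _ Ax)).
Qed.

(** The antiderivative [a^-1 sin (a x + phi)], with [a = 2 pi m], takes equal values at 0 and 1. *)
Lemma integral_cos_itv (m : int) (phi : R) : m != 0 ->
  (\int[lebesgue_measure]_(x in `[0%R, 1%R]%classic)
    (cos (2 * pi * (m%:~R * x) + phi))%:E)%E = 0%E.
Proof.
move=> m0.
have a0 : 2 * pi * m%:~R != 0 :> R.
  by rewrite !mulf_neq0 ?pnatr_eq0 ?intr_eq0// gt_eqF// pi_gt0.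
set a := 2 * pi * m%:~R in a0.
pose F x : R := a^-1 * sin (a * x + phi).
have dF (x : R) : is_derive x (1 : R) F (cos (a * x + phi)).
  pose g : R -> R := (a \*: id) + cst phi.
  have dg : is_derive x (1 : R) g (a * 1 + 0 : R) by exact: is_deriveD.
  have /(is_deriveZ a^-1) :
      is_derive x (1 : R) (sin \o g) (cos (g x) * (a * 1 + 0)).
    exact: is_derive1_comp.
  by rewrite addr0 /GRing.scale /= mulr1 mulrCA mulVf// mulr1.
have cF : continuous F.
  by move=> x; apply/differentiable_continuous/derivable1_diffP; case: (dF x).
have cf : continuous (fun x => cos (a * x + phi)).
  move=> x; apply: continuous_comp; last exact: continuous_cos.
  by apply: cvgD; [apply: cvgM; [exact: cvg_cst|exact: cvg_id]|exact: cvg_cst].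
under eq_integral do rewrite mulrA -/a.
rewrite (@continuous_FTC2 _ (fun x => cos (a * x + phi)) F) ?ltr01//.
- rewrite -EFinB /F -mulrBr; congr EFin.
  have [a_cos a_sin] : cos a = 1 /\ sin a = 0.
    by have := expi2pi_int R m; case.
  by rewrite mulr1 mulr0 add0r sinD a_cos a_sin mul0r mul1r add0r subrr mulr0.
- exact: continuous_subspaceT.
- split.
  + by move=> x _; case: (dF x).
  + exact/cvg_at_right_filter/cF.
  + exact/cvg_at_left_filter/cF.
- by move=> x _; rewrite derive1E; apply: derive_val.
Qed.

Lemma integral_circle_cos (m : int) (phi : R) :
  (\int[circle_lebesgue (R := R)]_x
    (cos (2 * pi * (m%:~R * sval x) + phi))%:E =
   if m == 0%R then (cos phi)%:E else 0)%E.
Proof.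
have [->|m0] := eqVneq m 0.
  under eq_integral do rewrite mul0r mulr0 add0r.
  rewrite integral_cst//.
  by rewrite [X in (_ * X)%E](@probability_setT _ _ _ (@circle_lebesgue R)) mule1.
rewrite (integral_circle (f := fun x => cos (2 * pi * (m%:~R * x) + phi))).
  exact: integral_cos_itv.
apply: bounded_measurable_cos; apply: measurable_funD => //.
by do 2 apply: measurable_funM => //.
Qed.

Lemma bounded_measurable_cos_dotp d (k : 'I_d -> int) (phi : R) :
  bounded_measurable (fun x : torus R d => cos (2 * pi * dotp k x + phi)).
Proof.
apply: bounded_measurable_cos; apply: measurable_funD => //.
by apply: measurable_funM => //; exact: measurable_dotp.
Qed.

(** The arbitrary phase makes the induction on [d] run: with the first coordinate frozen, its
    contribution joins [phi], the inner integral falls under the induction hypothesis, and the outer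
    one is [integral_circle_cos]. *)
Lemma integral_torus_cos d (k : 'I_d -> int) (phi : R) :
  (\int[torus_lebesgue R d]_x (cos (2 * pi * dotp k x + phi))%:E =
   if [forall i, k i == 0%R] then (cos phi)%:E else 0)%E.
Proof.
elim: d k phi => [|d IHd] k phi.
  rewrite (_ : [forall i, _] = true); last by apply/forallP; case.
  rewrite integral_dirac//; last first.
    apply/measurable_EFinP; have [mc _] := bounded_measurable_cos_dotp k phi.
    exact: mc.
  by rewrite diracT mul1e /dotp big_ord0 mulr0 add0r.
have [mc bc] := bounded_measurable_cos_dotp k phi.
rewrite /torus_lebesgue /=.
have dotp_cons (x : circle R) (y : torus R d) :
    dotp k (Defs.cons_tuple (x, y)) =
    (k ord0)%:~R * sval x + dotp (k \o lift ord0) y.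
  rewrite /dotp big_ord_recl /Defs.coord tnth0; congr (_ + _).
  by apply: eq_bigr => i _; rewrite tnthS.
pose P : probability (circle R * d.-tuple (circle R))%type R :=
  (@circle_lebesgue R \x torus_lebesgue R d)%E.
have int_cons : P.-integrable setT
    (EFin \o (fun z => cos (2 * pi * dotp k (Defs.cons_tuple z) + phi))).
  apply: bounded_measurable_integrable; split; last first.
    by have [M cM] := bc; exists M => z; exact: cM.
  apply: (measurableT_comp mc); exact: measurable_cons.
rewrite integral_distribution//; last exact/measurable_EFinP.
rewrite -(integral12_prod_meas1 int_cons) /fubini_F /=.
under eq_integral => x _.
  under eq_integral => y _ do
    rewrite dotp_cons mulrDr [X in X + _]addrC -addrA.
  rewrite -/(torus_lebesgue R d) IHd.
  over.
have -> : [forall i, k i == 0] =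
    (k ord0 == 0) && [forall i, (k \o lift ord0) i == 0].
  apply/forallP/andP => [k0|[k0 /forallP k1] i].
    by split => //; apply/forallP => i; exact: k0.
  by case: (unliftP ord0 i) => [j ->|->]; [exact: k1|].
case: [forall i, (k \o lift ord0) i == 0]; last by rewrite andbF integral0.
by rewrite andbT integral_circle_cos.
Qed.

End torus_integral.

(** * Moment matrices *)

Section positive_total_variation.
Context d (T : measurableType d) (R : realType).
Local Open Scope classical_set_scope.
Local Open Scope ring_scope.
Variable mu : complex_measure T R.

(** Since the modulus drops out, every measurable partition sums to [mu setT] by additivity, and the
    supremum is over a single value. *)
Lemma tv_norm_pos : (forall A, measurable A -> 0 <= mu A) ->
  tv_norm mu = (complex.Re (mu setT))%:E.
Proof.
move=> mu0; rewrite /tv_norm -[RHS]ereal_sup1; congr ereal_sup.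
have sumE (A : (set T)^nat) : (forall i, measurable (A i)) -> trivIset setT A ->
    \bigcup_i A i = setT ->
    (\sum_(i <oo) (Normc.normc (mu (A i)))%:E)%E = (complex.Re (mu setT))%:E.
  move=> mA tA AT.
  transitivity (\sum_(i <oo) cmeas_re mu (A i))%E.
    apply: eq_eseriesr => i _; rewrite /cmeas_re; congr EFin.
    by apply: complexI; rewrite RRe_real ?ger0_real ?mu0// -[RHS]ger0_norm ?mu0.
  apply/cvg_lim => //; rewrite -[X in _ --> X]/(cmeas_re mu setT) -AT.
  by apply: charge_semi_sigma_additive => //; rewrite AT.
apply/seteqP; split => [_ [A [mA tA AT] <-]|_ ->]; first exact: sumE.
(* The partition into the whole space and empty sets shows that this value is attained. *)
have m2 i : measurable (bigcup2 (setT : set T) set0 i).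
  by case: i => [|[|i]] /=.
have t2 : trivIset setT (bigcup2 (setT : set T) set0).
  by rewrite -trivIset_bigcup2 setI0.
have T2 : \bigcup_i bigcup2 (setT : set T) set0 i = setT.
  by rewrite bigcup2E setU0.
by exists (bigcup2 setT set0) => //; exact: sumE.
Qed.

End positive_total_variation.

(** * Quadratic forms of the moment matrix and Fejer means *)

Section moment_matrix.
Variables (R : realType) (d n : nat) (mu : complex_measure (torus R d) R).
Local Notation T := (moment_mx mu n).
Local Notation N := (n.+1 ^ d)%N.

Lemma bilinear_mxE (C : numClosedFieldType) m (A : 'M[C]_m) (v w : 'cV[C]_m) :
  (v^t* *m A *m w) 0 0 = \sum_j \sum_l (v j 0)^* * A j l * w l 0.
Proof.
rewrite mxE exchange_big /=; apply: eq_bigr => l _.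
by rewrite mxE mulr_suml; apply: eq_bigr => j _; rewrite !mxE.
Qed.

Lemma cbounded_measurable_expi2pi (f : torus R d -> R) :
  measurable_fun setT f -> cbounded_measurable (fun y => expi2pi (f y)).
Proof.
move=> mf; have m : measurable_fun setT (fun y => 2 * pi * f y).
  exact: measurable_funM.
by split; [exact: bounded_measurable_cos | exact: bounded_measurable_sin].
Qed.

Lemma expvecE (j l : 'I_N) x : expvec n x j 0 * (expvec n x l 0)^* =
  expi2pi (- dotp (fun i => multi_index j i - multi_index l i) x) :> R[i].
Proof. by rewrite !mxE -expi2piN -expi2piD dotpB opprD. Qed.

Lemma conj_expvecE (j l : 'I_N) x :
  expi2pi (dotp (fun i => multi_index j i - multi_index l i) x) =
  (expvec n x j 0)^* * expvec n x l 0 :> R[i].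
Proof. by rewrite !mxE -expi2piN -expi2piD opprK dotpB. Qed.

Lemma moment_mxE j l : T j l =
  cintegral mu (fun y => expvec n y j 0 * (expvec n y l 0)^*).
Proof.
by rewrite mxE /moment; congr cintegral; apply/funext => y; rewrite expvecE.
Qed.

Let cbm_expvec j l :
  cbounded_measurable (fun y : torus R d => expvec n y j 0 * (expvec n y l 0)^*).
Proof.
rewrite (funext (expvecE j l)).
apply: cbounded_measurable_expi2pi; apply: measurable_funN.
exact: measurable_dotp.
Qed.

Lemma fejer_convE x : fejer_conv mu n x =
  ((expvec n x)^t* *m T *m expvec n x) 0 0 / n.+1%:R ^+ d.
Proof.
rewrite bilinear_mxE mulrC /fejer_conv.
(* Each character of [x - y] splits into a coefficient depending on [x] and the integrand of a
   moment in [y]. *)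
have -> : (fun y => fejer n (tsub x y)) = (fun y => (n.+1%:R ^+ d)^-1 *
    \sum_j \sum_l ((expvec n x j 0)^* * expvec n x l 0) *
      (expvec n y j 0 * (expvec n y l 0)^*)).
  apply/funext => y; rewrite fejerE; congr (_ * _).
  apply: eq_bigr => j _; apply: eq_bigr => l _.
  rewrite expi2pi_dotp_tsub expvecE; congr (_ * _).
  exact: conj_expvecE.
have cZ j l c : cbounded_measurable (fun y : torus R d =>
    c * (expvec n y j 0 * (expvec n y l 0)^*)).
  by apply: cbounded_measurableM => //; exact: cbounded_measurable_cst.
rewrite cintegralZ; last first.
  by apply: cbounded_measurable_sum => j; apply: cbounded_measurable_sum => l.
congr (_ * _); rewrite cintegral_sum; last first.
  by move=> j; apply: cbounded_measurable_sum => l.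
apply: eq_bigr => j _; rewrite cintegral_sum//; apply: eq_bigr => l _.
by rewrite cintegralZ// -moment_mxE mulrAC.
Qed.

(** For real [mu], conjugation passes under the integral, where it exchanges the roles of [j] and
    [l]. *)
Lemma moment_mx_herm : (forall A, measurable A -> mu A \is Num.real) ->
  T \is hermsymmx.
Proof.
move=> mu_real; apply/hermsymmxP/matrixP => j l; rewrite 2!mxE !moment_mxE.
rewrite conj_cintegral//; congr cintegral; apply/funext => y.
by rewrite rmorphM /= conjCK mulrC.
Qed.

Lemma moment_mx_psd : (forall A, measurable A -> 0 <= mu A) -> psdmx T.
Proof.
move=> mu0; split; first by apply: moment_mx_herm => A /mu0 /ger0_real.
move=> v; rewrite bilinear_mxE.
suff -> : \sum_j \sum_l (v j 0)^* * T j l * v l 0 =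
    cintegral mu (fun y => `|\sum_j (v j 0)^* * expvec n y j 0| ^+ 2).
  by apply: cintegral_ge0 => // y; rewrite exprn_ge0.
have -> : (fun y => `|\sum_j (v j 0)^* * expvec n y j 0| ^+ 2) =
   (fun y => \sum_j \sum_l (v j 0)^* * v l 0 *
      (expvec n y j 0 * (expvec n y l 0)^*)).
  apply/funext => y; rewrite normCK rmorph_sum big_distrlr /=.
  apply: eq_bigr => j _; apply: eq_bigr => l _.
  by rewrite rmorphM /= conjCK mulrACA.
have cZ j l c : cbounded_measurable (fun y : torus R d =>
    c * (expvec n y j 0 * (expvec n y l 0)^*)).
  by apply: cbounded_measurableM => //; exact: cbounded_measurable_cst.
rewrite cintegral_sum; last by move=> j; apply: cbounded_measurable_sum => l.
apply: eq_bigr => j _; rewrite cintegral_sum//; apply: eq_bigr => l _.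
by rewrite cintegralZ// -moment_mxE mulrAC.
Qed.

(** Orthogonality of characters, in real-part form because the L1 norm integrates real functions. *)
Lemma integral_torus_Re (c : R[i]) (k : 'I_d -> int) :
  (\int[torus_lebesgue R d]_x (complex.Re (c * expi2pi (dotp k x)))%:E =
   if [forall i, k i == 0%R] then (complex.Re c)%:E else 0)%E.
Proof.
have bZ a phi : bounded_measurable
    (fun x : torus R d => a * cos (2 * pi * dotp k x + phi)).
  apply: bounded_measurableM; first exact: bounded_measurable_cst.
  exact: bounded_measurable_cos_dotp.
have iZ a phi : (\int[torus_lebesgue R d]_x
    (a * cos (2 * pi * dotp k x + phi))%:E)%E =
    if [forall i, k i == 0] then (a * cos phi)%:E else 0%E.
  under eq_integral do rewrite EFinM.
  rewrite integralZl//; last first.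
    exact/bounded_measurable_integrable/bounded_measurable_cos_dotp.
  by rewrite integral_torus_cos; case: ifP; rewrite ?mule0.
(* As [- sin t = cos (t + pi / 2)], both parts of [Re (c e^(i t))] are cosines with a phase; the
   second one contributes [cos (pi / 2) = 0] at frequency zero. *)
transitivity (\int[torus_lebesgue R d]_x
   ((complex.Re c * cos (2 * pi * dotp k x + 0))%:E +
    (complex.Im c * cos (2 * pi * dotp k x + pi / 2))%:E))%E.
  apply: eq_integral => x _; rewrite -EFinD; congr EFin.
  by rewrite ReM /= addr0 cosDpihalf mulrN.
rewrite integralD//; try exact: bounded_measurable_integrable.
rewrite !iZ cos0 cos_pihalf mulr1 mulr0.
by case: ifP; rewrite ?adde0.
Qed.

(** By injectivity of the enumeration, frequency zero occurs only on the diagonal. *)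
Lemma multi_index_eq0 (j l : 'I_N) :
  [forall i, multi_index j i - multi_index l i == 0] = (j == l).
Proof.
apply/forallP/eqP => [jl|-> i]; last by rewrite subrr.
apply: (can_inj (cast_ordK (card_multi_index d n))).
apply: enum_val_inj; apply/ffunP => i; apply: val_inj => /=.
by have := jl i; rewrite subr_eq0 => /eqP[].
Qed.

Lemma moment_mx_diag j : T j j = mu setT.
Proof.
rewrite moment_mxE -[RHS]cintegral1; congr cintegral; apply/funext => y.
by rewrite !mxE -expi2piN -expi2piD subrr expi2pi0.
Qed.

Lemma torus_L1norm_fejer_conv : (forall A, measurable A -> 0 <= mu A) ->
  torus_L1norm (fejer_conv mu n) = (complex.Re (mu setT))%:E.
Proof.
move=> mu0; rewrite /torus_L1norm.
have n1 : (n.+1%:R ^+ d : R[i]) != 0 by rewrite expf_neq0// pnatr_eq0.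
transitivity (\int[torus_lebesgue R d]_x
    (\sum_(j < N) \sum_(l < N) (complex.Re (T j l / n.+1%:R ^+ d *
       expi2pi (dotp (fun i => multi_index j i - multi_index l i) x)))%:E))%E.
  apply: eq_integral => x _.
  (* The Fejer mean is a positive multiple of the quadratic form of [T] at [expvec n x], hence equal
     to its own modulus. *)
  have p0 : 0 <= fejer_conv mu n x.
    rewrite fejer_convE divr_ge0 ?exprn_ge0 ?ler0n//.
    exact: (moment_mx_psd mu0).2.
  transitivity (complex.Re (fejer_conv mu n x))%:E.
    congr EFin; apply: complexI; rewrite RRe_real ?ger0_real//.
    by rewrite -[RHS]ger0_norm.
  rewrite fejer_convE bilinear_mxE mulr_suml.
  rewrite (big_morph _ (@ReD R) (erefl : complex.Re 0 = 0)) -sumEFin.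
  apply: eq_bigr => j _; rewrite mulr_suml.
  rewrite (big_morph _ (@ReD R) (erefl : complex.Re 0 = 0)) -sumEFin.
  apply: eq_bigr => l _; congr (complex.Re _)%:E.
  rewrite conj_expvecE.
  by rewrite [RHS]mulrCA !mulrA [LHS]mulrAC.
have mI j l : bounded_measurable (fun x : torus R d =>
    complex.Re (T j l / n.+1%:R ^+ d *
       expi2pi (dotp (fun i => multi_index j i - multi_index l i) x))).
  suff [] : cbounded_measurable (fun x : torus R d => T j l / n.+1%:R ^+ d *
      expi2pi (dotp (fun i => multi_index j i - multi_index l i) x)) by [].
  apply: cbounded_measurableM; first exact: cbounded_measurable_cst.
  by apply: cbounded_measurable_expi2pi; exact: measurable_dotp.
rewrite integral_sum//; last first.
  move=> j; apply: integrable_sum => // l _.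
  exact/bounded_measurable_integrable/mI.
transitivity (\sum_(j < N) (complex.Re (T j j / n.+1%:R ^+ d))%:E)%E.
  apply: eq_bigr => j _; rewrite integral_sum//; last first.
    by move=> l; exact/bounded_measurable_integrable/mI.
  rewrite (bigD1 j)//= integral_torus_Re multi_index_eq0 eqxx big1 ?adde0//.
  by move=> l lj; rewrite integral_torus_Re multi_index_eq0 eq_sym (negbTE lj).
rewrite sumEFin; congr EFin.
rewrite -(big_morph _ (@ReD R) (erefl : complex.Re 0 = 0)).
under eq_bigr do rewrite moment_mx_diag.
(* The [(n + 1)^d] diagonal entries all equal [mu setT], and their number cancels the
   normalisation. *)
by rewrite sumr_const card_ord -[_ *+ _]mulr_natr natrX mulfVK.
Qed.

End moment_matrix.

(** * Singular value expansions *)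

Lemma diag_bilinear_mxE (C : numClosedFieldType) m (s : 'I_m -> C)
  (a b : 'rV[C]_m) :
  (a *m diag_mx (\row_j s j) *m b^t*) 0 0 = \sum_j s j * a 0 j * (b 0 j)^*.
Proof.
by rewrite mxE; apply: eq_bigr => j _; rewrite mul_mx_diag !mxE [s j * _]mulrC.
Qed.

Theorem lemma2p3 (R : realType) (d n : nat) (d_gt0 : (0 < d)%N)
    (n_gt0 : (0 < n)%N) (mu : complex_measure (torus R d) R) (Mmu : measM mu)
    (U V : 'M[R[i]]_(n.+1 ^ d)) (sigma : 'I_(n.+1 ^ d) -> R)
    (svd : is_svd (moment_mx mu n) U sigma V) :
  let T := moment_mx mu n in
  let p := fejer_conv mu n in
  let e := expvec n in
  let u j (x : torus R d) := ((e x)^t* *m U) 0 j in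
  let v j (x : torus R d) := ((e x)^t* *m V) 0 j in
  [/\ forall x, p x = ((e x)^t* *m T *m e x) 0 0 / n.+1%:R ^+ d /\
        ((e x)^t* *m T *m e x) 0 0 / n.+1%:R ^+ d =
          (n.+1%:R ^+ d)^-1 * \sum_j (sigma j)%:C * u j x * (v j x)^*,
      measM_real mu -> T \is hermsymmx
    & measM_pos mu ->
      [/\ psdmx T,
          torus_L1norm p = tv_norm mu /\ tv_norm mu = 1%E
        & forall x, p x =
            (n.+1%:R ^+ d)^-1 * \sum_j (sigma j)%:C * `|u j x| ^+ 2]].
Proof.
move=> T p e u v; have [uU uV s0 TE] := svd.
have pE x : p x = ((e x)^t* *m T *m e x) 0 0 / n.+1%:R ^+ d.
  exact: fejer_convE.
(* Stated for any [W]: [W = V] gives the singular value expansion, [W = U] the one with squared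
   moduli. *)
have quadE (W : 'M[R[i]]_(n.+1 ^ d)) x :
    ((e x)^t* *m (U *m diag_mx (\row_j (sigma j)%:C) *m W^t*) *m e x) 0 0 =
    \sum_j (sigma j)%:C * u j x * (((e x)^t* *m W) 0 j)^*.
  rewrite -diag_bilinear_mxE; congr (fun_of_matrix _ 0 0).
  by rewrite conjtM trmxCK !mulmxA.
split.
- move=> x; split; first exact: pE.
  by rewrite {1}/T TE quadE mulrC.
- by move=> [_ mu_real]; exact: moment_mx_herm.
- move=> [[_ mu1] mu0].
  have Tpsd : psdmx T by exact: moment_mx_psd.
  split => //.
    by rewrite (torus_L1norm_fejer_conv _ mu0) tv_norm_pos// mu1.
  have TU : T = U *m diag_mx (\row_j (sigma j)%:C) *m U^t*.
    have [hT T0] := Tpsd.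
    by apply: svd_psd TE hT T0 => // j; rewrite ler0c.
  move=> x; rewrite pE TU quadE mulrC; congr (_ * _).
  by apply: eq_bigr => j _; rewrite -mulrA -normCK.
Qed.
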